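(* Let $n\ge 1$, let $\mathcal{L}^+$ be the set of all real $n\times n$ lower triangular matrices with positive diagonal entries, and let $\mathcal{S}^+$ be the set of all real $n\times n$ positive definite symmetric matrices. Let $\overline{\mathcal{L}}^+$ and $\overline{\mathcal{S}}^+$ be the closures of these sets in the space of real $n\times n$ matrices, and let $F:\overline{\mathcal{L}}^+\to\overline{\mathcal{S}}^+$ be the map $F(L)=LL^T$. Then: (1) The map $F$ is proper, i.e. the inverse image under $F$ of every compact set is compact. (2) The restriction of $F$ to $\mathcal{L}^+$ is an analytic diffeomorphism onto its image, and this image is $F(\mathcal{L}^+)=\mathcal{S}^+$. (3) Every real $n\times n$ non-negative definite symmetric matrix $A$ can be written as $A=LL^T$, where $L$ is a real lower triangular matrix with non-negative diagonal entries. Moreover, such a decomposition is unique if $A$ is positive definite.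
   Context: $\mathcal{L}^+$ is regarded as an open subset of the vector space of real lower triangular $n\times n$ matrices, and $\mathcal{S}^+$ as an open subset of the vector space of real symmetric $n\times n$ matrices. An analytic diffeomorphism is a bijection between real-analytic manifolds that is real-analytic with real-analytic inverse. *)

(* Defs.v *)
From HB Require Import structures.
From mathcomp Require Import all_boot all_order all_algebra.
From mathcomp Require Import all_classical all_reals all_analysis.

Set Implicit Arguments.
Unset Strict Implicit.
Unset Printing Implicit Defensive.

Import Order.TTheory GRing.Theory Num.Theory.
Import numFieldNormedType.Exports.

Local Open Scope classical_set_scope.
Local Open Scope ring_scope.

Definition sym_mx (R : realType) (n : nat) (A : 'M[R]_n) : Prop := A^T = A.

Definition posdef_mx (R : realType) (n : nat) (A : 'M[R]_n) : Prop :=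
  sym_mx A /\ forall v : 'cV[R]_n, v != 0 -> 0 < (v^T *m A *m v) 0 0.

Definition nonnegdef_mx (R : realType) (n : nat) (A : 'M[R]_n) : Prop :=
  sym_mx A /\ forall v : 'cV[R]_n, 0 <= (v^T *m A *m v) 0 0.

(* [is_trig_mx] means lower triangular: A i j = 0 whenever i < j. *)
Definition Lplus (R : realType) (n : nat) : set 'M[R]_n :=
  [set L | is_trig_mx L /\ forall i, 0 < L i i].

Definition Splus (R : realType) (n : nat) : set 'M[R]_n :=
  [set A | posdef_mx A].

(* A total function, only considered on subsets of
   [closure (Lplus R n)]. *)
Definition Fmap (R : realType) (n : nat) (L : 'M[R]_n) : 'M[R]_n := L *m L^T.

(* Compactness of a subset does not depend on the ambient space, so [compact]
   in the ambient type is compactness in A, resp. B. *)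
Definition proper_map (T U : topologicalType) (A : set T) (B : set U)
    (f : T -> U) : Prop :=
  set_fun A B f /\
  forall K : set U, K `<=` B -> compact K -> compact (A `&` f @^-1` K).

(* Partial sum, over the multi-indices a with all a_i < N, of the power series
   \sum_a c_a t^a in d variables.  For an absolutely convergent series these
   sums converge to its (unordered) sum. *)
Definition pseries_psum (R : realType) (d : nat) (c : {ffun 'I_d -> nat} -> R)
    (t : 'I_d -> R) (N : nat) : R :=
  \sum_(a : {ffun 'I_d -> 'I_N})
    c [ffun i => a i : nat] * \prod_(i < d) t i ^+ a i.

Definition pseries_abs_cvg (R : realType) (d : nat)
    (c : {ffun 'I_d -> nat} -> R) (t : 'I_d -> R) : Prop :=
  cvgn (pseries_psum (fun a => `|c a|) (fun i => `|t i|)).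

(* Real-analyticity at the point x of E of a scalar function on the
   finite-dimensional vector space E: it is, on some polydisc around x, the sum
   of an absolutely convergent power series in the linear coordinates of E.
   Only the values of f on E near x matter, and the notion does not depend on
   the choice of the basis of E. *)
Definition analytic_at (R : realType) (V : vectType R) (E : {vspace V})
    (f : V -> R) (x : V) : Prop :=
  exists r : R, exists c : {ffun 'I_(\dim E) -> nat} -> R,
    0 < r /\
    forall h : V, h \in E ->
      let t := fun i : 'I_(\dim E) => coord (vbasis E) i h in
      (forall i, `|t i| < r) ->
      pseries_abs_cvg c t /\ pseries_psum c t @ \oo --> f (x + h).

(* Real-analyticity of f on a subset U of E, as a map from U to the
   finite-dimensional vector space E': all linear coordinates of f in E' are
   real-analytic at all points of U. *)
Definition analytic_map (R : realType) (V W : vectType R)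
    (E : {vspace V}) (U : set V) (E' : {vspace W}) (f : V -> W) : Prop :=
  forall x, U x ->
    f x \in E' /\
    forall j : 'I_(\dim E'),
      analytic_at E (fun y => coord (vbasis E') j (f y)) x.

Definition open_in (R : realType) (m n : nat) (E : {vspace 'M[R]_(m, n)})
    (U : set 'M[R]_(m, n)) : Prop :=
  exists2 O : set 'M[R]_(m, n), open O & U = O `&` [set` E].

(* f restricts to a real-analytic diffeomorphism from the open subset U of the
   vector space E onto the open subset U' of the vector space E'. *)
Definition analytic_diffeo (R : realType) (m n m' n' : nat)
    (E : {vspace 'M[R]_(m, n)}) (U : set 'M[R]_(m, n))
    (E' : {vspace 'M[R]_(m', n')}) (U' : set 'M[R]_(m', n'))
    (f : 'M[R]_(m, n) -> 'M[R]_(m', n')) : Prop :=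
  [/\ open_in E U, open_in E' U', set_bij U U' f, analytic_map E U E' f &
      exists g : 'M[R]_(m', n') -> 'M[R]_(m, n),
        (forall x, U x -> g (f x) = x) /\ analytic_map E' U' E g].

Section MatrixSubspaces.
Variables (R : realType) (n : nat).

Definition strict_upper (A : 'M[R]_n) : 'M[R]_n :=
  \matrix_(i, j) if (i < j)%N then A i j else 0.

Lemma strict_upper_is_linear : linear strict_upper.
Proof.
move=> a A B; apply/matrixP => i j; rewrite !mxE.
by case: ifP => // _; rewrite mulr0 addr0.
Qed.

HB.instance Definition _ :=
  GRing.isLinear.Build R 'M[R]_n 'M[R]_n _ strict_upper strict_upper_is_linear.

Definition skew_part (A : 'M[R]_n) : 'M[R]_n := A^T - A.

Lemma skew_part_is_linear : linear skew_part.
Proof.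
by move=> a A B; apply/matrixP => i j; rewrite !mxE mulrBr opprD addrACA.
Qed.

HB.instance Definition _ :=
  GRing.isLinear.Build R 'M[R]_n 'M[R]_n _ skew_part skew_part_is_linear.

Definition ltrig_space : {vspace 'M[R]_n} := lker (linfun strict_upper).

Definition sym_space : {vspace 'M[R]_n} := lker (linfun skew_part).

Lemma mem_ltrig_space A : (A \in ltrig_space) = is_trig_mx A.
Proof.
rewrite memv_ker lfunE /=; apply/eqP/is_trig_mxP => [A0 i j ij|A0].
  by move/matrixP: A0 => /(_ i j); rewrite !mxE ij.
by apply/matrixP => i j; rewrite !mxE; case: ifP => // /A0.
Qed.

Lemma mem_sym_space A : A \in sym_space <-> sym_mx A.
Proof.
rewrite memv_ker lfunE /= /skew_part subr_eq0.
by split => [/eqP//|A0]; apply/eqP.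
Qed.

End MatrixSubspaces.

(* Main.v *)
(* Row-by-row comparison of A with L L^T determines L in L+ from A: the diagonal
   entry is the square root of a pivot of A, and the entries below it are
   quotients by that root.  This algorithm gives injectivity and is itself the
   inverse map; it is analytic because sums, products, inverses and square roots
   of analytic functions are.  For the last two, dividing by the value at the
   centre reduces to 1 - u with u vanishing there, and both 1/(1 - u) and
   sqrt (1 - u) come from a quadratic fixed-point equation
   v = alpha + u (beta v + gamma v^2), whose formal solution is obtained degree
   by degree and is bounded in a weighted l^1 norm once the polydisc is small
   enough.  Properness holds because the diagonal of L L^T bounds all entries
   of L. *)
Require Import Defs.
From HB Require Import structures.
From mathcomp Require Import all_boot all_order all_algebra.
From mathcomp Require Import all_classical all_reals all_analysis.
From mathcomp Require Import ring lra.

Set Implicit Arguments.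
Unset Strict Implicit.
Unset Printing Implicit Defensive.

Import Order.TTheory GRing.Theory Num.Theory.
Import numFieldNormedType.Exports.

Local Open Scope classical_set_scope.
Local Open Scope ring_scope.

(** * Sums over multi-indices *)

Section MultiindexSums.
Variables (R : realType) (d : nat).
Local Notation I := {ffun 'I_d -> nat}.
Implicit Types (x y : I -> R) (a b : I) (M N : nat).

(** The index set of [pseries_psum], as a duplicate-free list of [nat]-valued functions, so that
    boxes of different sizes have one common type. *)
Definition box N : seq I :=
  [seq [ffun i => a i : nat] | a : {ffun 'I_d -> 'I_N}].

Lemma mem_box N a : (a \in box N) = [forall i, (a i < N)%N].
Proof.
apply/mapP/forallP => [[b _ ->] i|aN]; first by rewrite ffunE.
by exists [ffun i => Ordinal (aN i)]; rewrite ?mem_enum//;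
  apply/ffunP => i; rewrite !ffunE.
Qed.

Lemma box_uniq N : uniq (box N).
Proof.
rewrite map_inj_uniq ?enum_uniq// => b c /ffunP bc; apply/ffunP => i.
by apply/val_inj; have := bc i; rewrite !ffunE.
Qed.

Lemma sub_box M N : (M <= N)%N -> {subset box M <= box N}.
Proof.
move=> MN a; rewrite !mem_box => /forallP aM; apply/forallP => i.
exact: leq_trans MN.
Qed.

Definition pbox N : seq (I * I) := [seq (a, b) | a <- box N, b <- box N].

Lemma mem_pbox N p : (p \in pbox N) = (p.1 \in box N) && (p.2 \in box N).
Proof.
by case: p => a b; apply/allpairsP/andP => [[[c e] /= [? ? [-> ->]]]|[? ?]];
  last exists (a, b).
Qed.

Lemma pbox_uniq N : uniq (pbox N).
Proof.
by apply: allpairs_uniq; rewrite ?box_uniq// => -[a b] [c e] _ _ [/= -> ->].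
Qed.

Definition mdeg a : nat := \sum_i a i.

Lemma maddE a b i : (a + b) i = (a i + b i)%N.
Proof. by rewrite ffunE. Qed.

Lemma mdegD a b : mdeg (a + b) = (mdeg a + mdeg b)%N.
Proof. by rewrite /mdeg -big_split; apply: eq_bigr => i _; rewrite maddE. Qed.

Lemma mdeg_ge a i : (a i <= mdeg a)%N.
Proof. by rewrite /mdeg (bigD1 i)//= leq_addr. Qed.

Lemma mdeg0 a : (mdeg a == 0)%N = (a == 0).
Proof.
apply/idP/eqP => [|->]; last by rewrite /mdeg big1// => i _; rewrite ffunE.
rewrite sum_nat_eq0 => /forallP a0; apply/ffunP => i.
by rewrite ffunE; apply/eqP/(implyP (a0 i)).
Qed.

Lemma mem_box_mdeg a N : (mdeg a < N)%N -> a \in box N.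
Proof.
by move=> aN; rewrite mem_box; apply/forallP => i; apply: leq_ltn_trans aN;
  apply: mdeg_ge.
Qed.

Lemma mdeg_box a N : a \in box N -> (mdeg a <= d * N)%N.
Proof.
rewrite mem_box => /forallP aN.
rewrite -[d in (d * _)%N]card_ord -sum_nat_const leq_sum// => i _.
exact: ltnW.
Qed.

Definition boxsum x N : R := \sum_(a <- box N) x a.

Lemma ler_sum_subset (T : eqType) (s s' : seq T) (P : pred T) (F : T -> R) :
    uniq s -> uniq s' -> {subset [seq i <- s | P i] <= s'} ->
    (forall i, 0 <= F i) ->
  \sum_(i <- s | P i) F i <= \sum_(i <- s') F i.
Proof.
move=> us us' ss' F0; rewrite [leRHS](bigID (mem [seq i <- s | P i]))/=.
rewrite -[leLHS]big_filter -[X in _ <= X + _]big_filter.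
rewrite (perm_big [seq i <- s' | i \in [seq i <- s | P i]])/=.
  by rewrite lerDl sumr_ge0.
apply: uniq_perm; rewrite ?filter_uniq// => i; rewrite [RHS]mem_filter.
by have [/ss'->|_] := boolP (i \in [seq i <- s | P i]).
Qed.

Lemma boxsum_nd x : (forall a, 0 <= x a) ->
  {homo boxsum x : M N / (M <= N)%N >-> M <= N}.
Proof.
move=> x0 M N MN; apply: ler_sum_subset; rewrite ?box_uniq// => a.
by rewrite mem_filter => /(sub_box MN).
Qed.

(** * Absolutely summable families *)

(** Absolute summability with an explicit constant, stated through finite sums so that estimates
    need no limits. *)
Definition abs_bound x (C : R) := forall N, boxsum (fun a => `|x a|) N <= C.

Lemma abs_bound_ge0 x C : abs_bound x C -> 0 <= C.
Proof. by move=> /(_ 0%N); apply: le_trans; apply: sumr_ge0 => a _. Qed.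

Lemma abs_bound_le x y C : (forall a, `|y a| <= `|x a|) ->
  abs_bound x C -> abs_bound y C.
Proof. by move=> yx xC N; apply: le_trans (xC N); apply: ler_sum => a _. Qed.

Lemma abs_boundD x y C D : abs_bound x C -> abs_bound y D ->
  abs_bound (x \+ y) (C + D).
Proof.
move=> xC yD N; apply: le_trans (lerD (xC N) (yD N)).
by rewrite -big_split/=; apply: ler_sum => a _; apply: ler_normD.
Qed.

Lemma abs_boundZ x C k : abs_bound x C ->
  abs_bound (fun a => k * x a) (`|k| * C).
Proof.
move=> xC N; apply: le_trans (ler_wpM2l (normr_ge0 k) (xC N)).
by rewrite mulr_sumr; apply: ler_sum => a _; rewrite normrM.
Qed.

Lemma boxsum_le_abs_bound x C N : abs_bound x C -> `|boxsum x N| <= C.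
Proof. by move=> /(_ N); apply: le_trans; apply: ler_norm_sum. Qed.

Lemma nneg_boxsum_cvg x C : (forall a, 0 <= x a) -> abs_bound x C ->
  cvgn (boxsum x).
Proof.
move=> x0 xC; apply: nondecreasing_is_cvgn; first exact: boxsum_nd.
exists C => _ [N _ <-]; apply: le_trans (ler_norm _) _.
exact: boxsum_le_abs_bound.
Qed.

(** Write [x = (x + |x|) - |x|]: both terms are nonnegative and summable, so their box sums converge
    by monotonicity. *)
Lemma boxsum_cvg x C : abs_bound x C -> cvgn (boxsum x).
Proof.
move=> xC; have absC : abs_bound (fun a => `|x a|) C.
  by apply: abs_bound_le xC => a; rewrite normr_id.
have -> : boxsum x = boxsum (fun a => x a + `|x a|) - boxsum (fun a => `|x a|).
  by apply/funext => N; rewrite fctE [boxsum (fun _ => _ + _) _]big_split addrK.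
apply: is_cvgB; last exact: nneg_boxsum_cvg absC.
apply: nneg_boxsum_cvg (abs_boundD xC absC) => a.
by rewrite -lerBlDl sub0r -normrN ler_norm.
Qed.

(* [pbox (mdeg a).+1] contains all pairs of multi-indices with sum [a]. *)
Definition cauchy_prod x y a : R :=
  \sum_(p <- pbox (mdeg a).+1 | p.1 + p.2 == a) x p.1 * y p.2.

(** Summands of [a] are at most [a] in each coordinate, so any box containing [a] already holds
    every pair with sum [a]. *)
Lemma cauchy_prod_box x y a N : a \in box N ->
  cauchy_prod x y a = \sum_(p <- pbox N | p.1 + p.2 == a) x p.1 * y p.2.
Proof.
move=> aN; rewrite /cauchy_prod -big_filter -[RHS]big_filter; apply: perm_big.
apply: uniq_perm; rewrite ?filter_uniq ?pbox_uniq// => -[b e].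
rewrite !mem_filter !mem_pbox/=; have [abe|//] := eqVneq (b + e) a.
rewrite -{}abe /= in aN *.
have [-> ->] : b \in box (mdeg (b + e)).+1 /\ e \in box (mdeg (b + e)).+1.
  by split; apply: mem_box_mdeg; rewrite ltnS mdegD ?leq_addr ?leq_addl.
move: aN; rewrite !mem_box => /forallP beN; apply/esym/andP; split;
  apply/forallP => i; apply: leq_ltn_trans (beN i); rewrite maddE.
- exact: leq_addr.
- exact: leq_addl.
Qed.

Lemma boxsum_cauchy_prod x y N : boxsum (cauchy_prod x y) N =
  \sum_(p <- pbox N | p.1 + p.2 \in box N) x p.1 * y p.2.
Proof.
rewrite /boxsum big_seq; under eq_bigr => a aN do rewrite (cauchy_prod_box _ _ aN).
rewrite (exchange_big_dep (fun p : I * I => p.1 + p.2 \in box N))/=; last first.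
  by move=> a p aN /eqP ->.
apply: eq_bigr => p pN.
rewrite -big_seq_cond -big_filter (eq_filter (a2 := pred1 (p.1 + p.2))).
  by rewrite filter_pred1_uniq ?box_uniq// big_seq1.
by move=> a /=; rewrite eq_sym.
Qed.

Lemma boxsumM x y N :
  boxsum x N * boxsum y N = \sum_(p <- pbox N) x p.1 * y p.2.
Proof.
by rewrite /boxsum mulr_suml big_allpairs; apply: eq_bigr => a _; rewrite mulr_sumr.
Qed.

Lemma boxsum_cauchy_prod_le x y N : (forall a, 0 <= x a) -> (forall a, 0 <= y a) ->
  boxsum (cauchy_prod x y) N <= boxsum x N * boxsum y N.
Proof.
move=> x0 y0; rewrite boxsumM boxsum_cauchy_prod.
rewrite [leRHS](bigID (fun p : I * I => p.1 + p.2 \in box N))/= lerDl.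
by apply: sumr_ge0 => p _; rewrite mulr_ge0.
Qed.

Lemma cauchy_prod_ge0 x y : (forall a, 0 <= x a) -> (forall a, 0 <= y a) ->
  forall a, 0 <= cauchy_prod x y a.
Proof. by move=> x0 y0 a; apply: sumr_ge0 => p _; rewrite mulr_ge0. Qed.

Lemma normr_cauchy_prod x y a :
  `|cauchy_prod x y a| <= cauchy_prod (fun b => `|x b|) (fun b => `|y b|) a.
Proof.
apply: le_trans (ler_norm_sum _ _ _) _; apply: ler_sum => p _.
by rewrite normrM.
Qed.

Lemma abs_bound_cauchy_prod x y C D : abs_bound x C -> abs_bound y D ->
  abs_bound (cauchy_prod x y) (C * D).
Proof.
move=> xC yD N; apply: (@le_trans _ _
  (boxsum (fun a => `|x a|) N * boxsum (fun a => `|y a|) N)).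
  apply: le_trans (boxsum_cauchy_prod_le _ _ _) => //.
  by apply: ler_sum => a _; apply: normr_cauchy_prod.
by apply: ler_pM => //; apply: sumr_ge0.
Qed.

(** Sums of two elements of box [N] lie in box [N + N], so the product of the [N]-th box sums lies
    between the [N]-th and the [(N + N)]-th box sum of the Cauchy product. *)
Lemma nneg_boxsum_cauchy_prod_lim x y C D (X Y : R) :
    (forall a, 0 <= x a) -> (forall a, 0 <= y a) ->
    abs_bound x C -> abs_bound y D ->
    boxsum x @ \oo --> X -> boxsum y @ \oo --> Y ->
  boxsum (cauchy_prod x y) @ \oo --> X * Y.
Proof.
move=> x0 y0 xC yD xX yY; set z := cauchy_prod x y.
have z0 : forall a, 0 <= z a by exact: cauchy_prod_ge0.
have zcv : cvgn (boxsum z) by apply: nneg_boxsum_cvg (abs_bound_cauchy_prod xC yD).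
have xyXY : boxsum x \* boxsum y @ \oo --> X * Y by exact: cvgM.
suff -> : X * Y = limn (boxsum z) by [].
apply/eqP; rewrite eq_le; apply/andP; split; last first.
  rewrite -(cvg_lim _ xyXY)//; apply: ler_lim => //.
    by apply/cvg_ex; exists (X * Y).
  by near=> N; apply: boxsum_cauchy_prod_le.
rewrite -(cvg_lim _ xyXY)//; apply: limr_le; first by apply/cvg_ex; exists (X * Y).
near=> N; apply: le_trans (nondecreasing_cvgn_le (boxsum_nd z0) zcv (N + N)%N).
rewrite /= boxsumM boxsum_cauchy_prod -[leRHS]big_filter.
apply: (ler_sum_subset (P := xpredT)); rewrite ?filter_uniq ?pbox_uniq//; last first.
  by move=> p; rewrite mulr_ge0.
move=> [a b]; rewrite filter_predT mem_filter !mem_pbox/= => /andP[aN bN].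
rewrite (sub_box (leq_addr N N) aN) (sub_box (leq_addr N N) bN) !andbT.
move: aN bN; rewrite !mem_box => /forallP aN /forallP bN; apply/forallP => i.
by rewrite maddE; apply: leq_trans (leq_add (aN i) (ltnW (bN i))).
Unshelve. all: by end_near. Qed.

Lemma boxsum_cauchy_prod_lim x y C D (X Y : R) : abs_bound x C -> abs_bound y D ->
    boxsum x @ \oo --> X -> boxsum y @ \oo --> Y ->
  boxsum (cauchy_prod x y) @ \oo --> X * Y.
Proof.
move=> xC yD xX yY.
pose x' a := `|x a|; pose y' a := `|y a|.
have x'C : abs_bound x' C by apply: abs_bound_le xC => a; rewrite normr_id.
have y'D : abs_bound y' D by apply: abs_bound_le yD => a; rewrite normr_id.
have x'cv := boxsum_cvg x'C; have y'cv := boxsum_cvg y'D.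
have diff0 : boxsum x' \* boxsum y' - boxsum (cauchy_prod x' y') @ \oo --> (0 : R).
  rewrite -(subrr (limn (boxsum x') * limn (boxsum y'))).
  apply: cvgB; first exact: cvgM.
  by apply: (nneg_boxsum_cauchy_prod_lim _ _ x'C y'D) => // a; apply: normr_ge0.
have xyXY : boxsum x \* boxsum y @ \oo --> X * Y by exact: cvgM.
rewrite -[X * Y]subr0 (_ : boxsum (cauchy_prod x y) = boxsum x \* boxsum y -
  (boxsum x \* boxsum y - boxsum (cauchy_prod x y))); last first.
  by apply/funext => N; rewrite !fctE/= opprB addrC subrK.
apply: cvgB => //; apply: norm_cvg0; apply: (squeeze_cvgr _ (cvg_cst 0) diff0).
near=> N; rewrite normr_ge0 !fctE/= !boxsumM !boxsum_cauchy_prod.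
(* Each difference is the sum over the pairs in the box whose sum leaves it; the one for absolute
   values dominates and tends to 0. *)
rewrite [X in _ <= X - _](bigID (fun p : I * I => p.1 + p.2 \in box N))/=.
rewrite [X in `|X - _|](bigID (fun p : I * I => p.1 + p.2 \in box N))/=.
rewrite ![_ + _ - _]addrAC !subrr !add0r.
by apply: le_trans (ler_norm_sum _ _ _) _; apply: ler_sum => p _; rewrite normrM.
Unshelve. all: by end_near. Qed.
End MultiindexSums.

(** * Power series *)

Section PowerSeries.
Variables (R : realType) (d : nat).
Local Notation I := {ffun 'I_d -> nat}.
Implicit Types (c e : I -> R) (a b : I) (t : 'I_d -> R) (r C : R).

Definition monom t a : R := \prod_(i < d) t i ^+ a i.

Lemma monomD t a b : monom t (a + b) = monom t a * monom t b.
Proof.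
by rewrite /monom -big_split; apply: eq_bigr => i _; rewrite maddE exprD.
Qed.

Lemma normr_monom t r a : (forall i, `|t i| <= r) ->
  `|monom t a| <= r ^+ mdeg a.
Proof.
move=> tr; rewrite /monom /mdeg -prodrXr normr_prod; apply: ler_prod => i _.
by rewrite normr_ge0 normrX lerXn2r ?nnegrE// (le_trans _ (tr i)).
Qed.

Lemma pseries_psumE c t : pseries_psum c t = boxsum (fun a => c a * monom t a).
Proof.
apply/funext => N; rewrite /boxsum big_image/=; apply: eq_bigr => a _.
by congr (_ * _); apply: eq_bigr => i _; rewrite ffunE.
Qed.

Lemma cauchy_prod_monom c e t a :
  cauchy_prod (fun b => c b * monom t b) (fun b => e b * monom t b) a =
  cauchy_prod c e a * monom t a.
Proof.
rewrite /cauchy_prod mulr_suml; apply: eq_bigr => p /eqP <-.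
by rewrite monomD mulrACA.
Qed.

Lemma cauchy_prod_expr c e r a :
  cauchy_prod (fun b => c b * r ^+ mdeg b) (fun b => e b * r ^+ mdeg b) a =
  cauchy_prod c e a * r ^+ mdeg a.
Proof.
rewrite /cauchy_prod mulr_suml; apply: eq_bigr => p /eqP <-.
by rewrite mdegD exprD mulrACA.
Qed.

(** For [r >= 0] this bounds a weighted l^1 norm, which is submultiplicative for the Cauchy product
    and controls the series on the closed polydisc of radius [r]. *)
Definition wbound r c C := abs_bound (fun a => c a * r ^+ mdeg a) C.

Lemma wboundD r c e C D : wbound r c C -> wbound r e D ->
  wbound r (c \+ e) (C + D).
Proof.
move=> cC eD N; rewrite /boxsum (eq_bigr (fun a => `|c a * r ^+ mdeg a +
  e a * r ^+ mdeg a|)) => [|a _]; first exact: (abs_boundD cC eD N).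
by rewrite mulrDl.
Qed.

Lemma wboundZ r c C k : wbound r c C -> wbound r (fun a => k * c a) (`|k| * C).
Proof.
move=> cC N; have := abs_boundZ k cC N; apply: le_trans.
by apply: ler_sum => a _; rewrite mulrA.
Qed.

Lemma wbound_cauchy_prod r c e C D : wbound r c C -> wbound r e D ->
  wbound r (cauchy_prod c e) (C * D).
Proof.
move=> cC eD N; have := abs_bound_cauchy_prod cC eD N; apply: le_trans.
by apply: ler_sum => a _; rewrite cauchy_prod_expr.
Qed.

Lemma wbound_weaken r c C D : C <= D -> wbound r c C -> wbound r c D.
Proof. by move=> CD cC N; apply: le_trans (cC N) CD. Qed.

Lemma wbound_shrink r s c C : 0 <= s <= r -> wbound r c C -> wbound s c C.
Proof.
move=> /andP[s0 sr]; apply: abs_bound_le => a.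
rewrite !normrM ler_wpM2l// !normrX !ger0_norm// ?lerXn2r ?nnegrE//.
all: exact: le_trans sr.
Qed.

(** Without a constant term all degrees are at least 1, so shrinking the radius by [s] gains a
    factor [s]. This is how the norm is made small. *)
Lemma wbound_scale r s c C : c 0 = 0 -> 0 <= s <= 1 ->
  wbound r c C -> wbound (s * r) c (s * C).
Proof.
move=> c0 /andP[s0 s1] /(abs_boundZ s); rewrite ger0_norm//.
apply: abs_bound_le => a; have [->|a0] := eqVneq a 0.
  by rewrite c0 !mul0r normr0.
rewrite exprMn mulrCA !normrM ler_wpM2r ?mulr_ge0// normrX !ger0_norm//.
by rewrite -[leRHS]expr1 ler_wiXn2l// lt0n mdeg0.
Qed.

Definition kdelta a0 (k : R) a : R := if a == a0 then k else 0.

Lemma wbound_kdelta r a0 k : wbound r (kdelta a0 k) (`|k * r ^+ mdeg a0|).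
Proof.
move=> N; have [aN|aN] := boolP (a0 \in box d N).
  rewrite /boxsum (bigD1_seq a0)//= ?box_uniq// /kdelta eqxx big1 ?addr0// => a.
  by move=> /negbTE ->; rewrite mul0r normr0.
rewrite /boxsum big1_seq// => a /= aN'; rewrite /kdelta; case: eqP => [aa|_].
  by rewrite -aa aN' in aN.
by rewrite mul0r normr0.
Qed.

Definition pseries_sum r c C (f : ('I_d -> R) -> R) :=
  wbound r c C /\
  forall t, (forall i, `|t i| <= r) -> pseries_psum c t @ \oo --> f t.

Definition analytic0 (f : ('I_d -> R) -> R) :=
  exists r c C, 0 < r /\ pseries_sum r c C f.

Lemma wbound_monom r c C t : (forall i, `|t i| <= r) -> wbound r c C ->
  abs_bound (fun a => c a * monom t a) C.
Proof.
move=> tr; apply: abs_bound_le => a; rewrite !normrM ler_wpM2l//.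
exact: le_trans (normr_monom a tr) (ler_norm _).
Qed.

Lemma wbound_pseries_sum r c C : wbound r c C ->
  pseries_sum r c C (fun t => limn (pseries_psum c t)).
Proof.
move=> cC; split=> // t tr; rewrite pseries_psumE.
exact: boxsum_cvg (wbound_monom tr cC).
Qed.

Lemma pseries_sum_bound r c C f t : pseries_sum r c C f ->
  (forall i, `|t i| <= r) -> `|f t| <= C.
Proof.
move=> [cC cf] tr; have /cvg_norm ft := cf t tr.
rewrite -(cvg_lim _ ft)//; apply: limr_le; first by apply/cvg_ex; exists `|f t|.
by near=> N; rewrite pseries_psumE; apply/boxsum_le_abs_bound/(wbound_monom tr).
Unshelve. all: by end_near. Qed.

Lemma pseries_sum_shrink r s c C f : 0 <= s <= r ->
  pseries_sum r c C f -> pseries_sum s c C f.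
Proof.
move=> /andP[s0 sr] [cC cf]; split; first by apply: wbound_shrink cC; rewrite s0.
by move=> t ts; apply: cf => i; apply: le_trans sr.
Qed.

Lemma pseries_sumD r c e C D f g : pseries_sum r c C f -> pseries_sum r e D g ->
  pseries_sum r (c \+ e) (C + D) (f \+ g).
Proof.
move=> [cC cf] [eD eg]; split=> [|t tr]; first exact: wboundD.
have := cvgD (cf t tr) (eg t tr); rewrite !pseries_psumE.
rewrite (_ : boxsum _ + boxsum _ = boxsum (fun a => (c \+ e) a * monom t a)).
  exact.
apply/funext => N; rewrite fctE /boxsum -big_split; apply: eq_bigr => a _.
by rewrite mulrDl.
Qed.

Lemma pseries_sumZ r c C f k : pseries_sum r c C f ->
  pseries_sum r (fun a => k * c a) (`|k| * C) (fun t => k * f t).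
Proof.
move=> [cC cf]; split=> [|t tr]; first exact: wboundZ.
have := cvgM (cvg_cst k) (cf t tr); rewrite !pseries_psumE.
rewrite (_ : _ \* _ = boxsum (fun a => k * c a * monom t a)).
  exact.
apply/funext => N; rewrite /= /boxsum mulr_sumr; apply: eq_bigr => a _.
by rewrite mulrA.
Qed.

Lemma pseries_sumM r c e C D f g : pseries_sum r c C f -> pseries_sum r e D g ->
  pseries_sum r (cauchy_prod c e) (C * D) (f \* g).
Proof.
move=> [cC cf] [eD eg]; split=> [|t tr]; first exact: wbound_cauchy_prod.
rewrite pseries_psumE (_ : (fun a => cauchy_prod c e a * monom t a) =
    cauchy_prod (fun b => c b * monom t b) (fun b => e b * monom t b)); last first.
  by apply/funext => a; rewrite cauchy_prod_monom.
apply: (boxsum_cauchy_prod_lim (wbound_monom tr cC) (wbound_monom tr eD)).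
  by rewrite -pseries_psumE; apply: cf.
by rewrite -pseries_psumE; apply: eg.
Qed.

Lemma pseries_sum_kdelta r a0 k :
  pseries_sum r (kdelta a0 k) `|k * r ^+ mdeg a0| (fun t => k * monom t a0).
Proof.
split=> [|t tr]; first exact: wbound_kdelta.
apply: cvg_near_cst; exists (mdeg a0).+1 => //= N /= aN.
rewrite pseries_psumE /boxsum (bigD1_seq a0) ?box_uniq ?mem_box_mdeg//=.
rewrite /kdelta eqxx big1 ?addr0// => a /negbTE ->.
by rewrite mul0r.
Qed.

Lemma pseries_sum_ext r c C f g : (forall t, (forall i, `|t i| <= r) -> f t = g t) ->
  pseries_sum r c C f -> pseries_sum r c C g.
Proof. by move=> fg [cC cf]; split=> // t tr; rewrite -fg//; apply: cf. Qed.

Lemma pseries_sum_ext_coef r c e C f : c =1 e ->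
  pseries_sum r c C f -> pseries_sum r e C f.
Proof. by move=> ce; have -> : c = e by exact/funext. Qed.

Lemma pseries_sum_unique r c C D f g t : pseries_sum r c C f ->
  pseries_sum r c D g -> (forall i, `|t i| <= r) -> f t = g t.
Proof. by move=> [_ cf] [_ cg] tr; apply: cvg_unique (cf t tr) (cg t tr). Qed.

Lemma pseries_sum_at0 r c C f : 0 <= r -> pseries_sum r c C f ->
  f (fun=> 0) = c 0.
Proof.
move=> r0 [_ /(_ (fun=> 0))]; rewrite normr0 => /(_ (fun=> r0)) cf.
apply: cvg_unique cf _ => //; apply: cvg_near_cst; exists 1%N => //= N /= N0.
rewrite pseries_psumE /boxsum (bigD1_seq 0) ?box_uniq ?mem_box_mdeg//=; last first.
  by move: (mdeg0 (0 : I)); rewrite eqxx => /eqP ->.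
rewrite /monom big1 => [|i _]; last by rewrite ffunE expr0.
rewrite mulr1 big1 ?addr0// => a a0.
have [i ai|a0'] := pickP (fun i => a i != 0%N).
  by rewrite (bigD1 i)//= expr0n (negbTE ai) mul0r mulr0.
case/eqP: a0; apply/ffunP => i; rewrite ffunE; apply/eqP.
by have := a0' i => /negbFE.
Qed.

End PowerSeries.

(** * Analytic functions near the origin *)

Section AnalyticFunctions.
Variables (R : realType) (d : nat).
Local Notation I := {ffun 'I_d -> nat}.
Implicit Types (c e : I -> R) (a b : I) (t : 'I_d -> R) (r C : R).

(** * Formal fixed points and the quadratic equation *)

Definition agree k c e := forall a, (mdeg a < k)%N -> c a = e a.

(** Iterates from 0 stabilize degree by degree, as each application of [Phi] fixes one more degree.
    The limit inherits the bound because on each box it coincides with a single iterate. *)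
Lemma formal_fixpoint (Phi : (I -> R) -> (I -> R)) r C : 0 <= C ->
    (forall c e k, agree k c e -> agree k.+1 (Phi c) (Phi e)) ->
    (forall c, wbound r c C -> wbound r (Phi c) C) ->
  exists2 c, wbound r c C & Phi c =1 c.
Proof.
move=> C0 PhiC PhiB; pose it k := iter k Phi (fun=> 0).
have stab k j : agree k (it (k + j)%N) (it k).
  by elim: k => [|k IHk]; [move=> a | rewrite addSn; apply: PhiC IHk].
have itB k : wbound r (it k) C.
  elim: k => [N|k IHk]; last exact: PhiB.
  by rewrite /boxsum big1// => a _; rewrite mul0r normr0.
pose c a := it (mdeg a).+1 a.
have cit k : agree k c (it k).
  by move=> a ak; rewrite /c -[it k]/(it _) -(subnKC ak) stab.
exists c => [N|a].
  (* Degrees in box [N] are at most [d * N], so iterate [(d * N).+1] has the final coefficients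
     there. *)
  rewrite /boxsum big_seq; under eq_bigr => a aN.
    rewrite (cit (d * N).+1 a) ?ltnS ?mdeg_box//; over.
  by rewrite -big_seq; apply: itB.
rewrite (PhiC c _ (mdeg a).+1 (cit _)) ?leqnSn//.
by rewrite -[Phi _]/(it (mdeg a).+2) -(addn1 (mdeg a).+1) stab.
Qed.

Lemma agree_cauchy_prod k c c' e e' : agree k c c' -> agree k e e' ->
  agree k (cauchy_prod c e) (cauchy_prod c' e').
Proof.
move=> cc' ee' a ak; apply: eq_bigr => p /eqP pa; move: ak; rewrite -pa mdegD.
by move=> pk; rewrite cc' ?ee'//; apply: leq_ltn_trans pk;
  rewrite ?leq_addl ?leq_addr.
Qed.

(** Since [c] has no constant term, a coefficient of the product involves only strictly lower
    degrees of the other factor. *)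
Lemma agree_cauchy_prodS k c e e' : c 0 = 0 -> agree k e e' ->
  agree k.+1 (cauchy_prod c e) (cauchy_prod c e').
Proof.
move=> c0 ee' a; rewrite ltnS => ak; apply: eq_bigr => p /eqP pa.
have [->|p0] := eqVneq p.1 0; first by rewrite c0 !mul0r.
rewrite ee'//; apply: leq_trans ak; rewrite -pa mdegD.
by rewrite -[X in (X < _)%N]add0n ltn_add2r lt0n mdeg0.
Qed.

(* Solves v = alpha + u (beta v + gamma v^2) when u vanishes at the centre:
   (alpha, beta, gamma) = (1, 1, 0) inverts 1 - u, and (1/2, 0, 1/2) gives
   sqrt (1 - u) = 1 - u v. *)
Lemma analytic_quadratic (u : ('I_d -> R) -> R) (alpha beta gamma : R) :
    analytic0 u -> u (fun=> 0) = 0 ->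
  exists2 v, analytic0 v & exists2 r, 0 < r & forall t, (forall i, `|t i| <= r) ->
    `|u t * v t| <= 1 /\ v t = alpha + u t * (beta * v t + gamma * (v t * v t)).
Proof.
move=> [r [c [D [r0 uc]]]] u0.
have c0 : c 0 = 0 by rewrite -(pseries_sum_at0 (ltW r0) uc).
have D0 : 0 <= D by exact: abs_bound_ge0 uc.1.
pose C := `|alpha| + 1; have C1 : 1 <= C by rewrite lerDr.
have C0 : 0 < C by lra.
(* [K] dominates the norm of [beta e + gamma e^2] for [e] of norm at most [C], which keeps [Phi]
   inside that ball, and also [C] itself, which yields [|u v| <= 1]. *)
pose K := C + `|beta| * C + `|gamma| * (C * C).
have bC : 0 <= `|beta| * C by rewrite mulr_ge0// ltW.
have gC : 0 <= `|gamma| * (C * C) by rewrite !mulr_ge0// ltW.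
have K0 : 0 < K by rewrite /K; lra.
(* Chosen so that [s * D * K <= 1]; [D + 1] stays positive when [D = 0]. *)
pose s := Num.min 1 (K * (D + 1))^-1.
have s0 : 0 < s by rewrite /s lt_min ltr01 invr_gt0 mulr_gt0//; lra.
have s1 : s <= 1 by rewrite ge_min lexx.
pose r' := s * r; have r'0 : 0 < r' by rewrite mulr_gt0.
have r'r : 0 <= r' <= r by rewrite ltW//= ler_piMl// ltW.
pose eps := s * D.
have cE : wbound r' c eps by apply: (wbound_scale c0 _ uc.1); rewrite s1 ltW.
have eps0 : 0 <= eps by rewrite mulr_ge0// ltW.
have epsK : eps * K <= 1.
  apply: (@le_trans _ _ ((K * (D + 1))^-1 * D * K)).
    by rewrite ler_wpM2r ?(ltW K0)// ler_wpM2r// ge_min lexx orbT.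
  rewrite -mulrA [X in X <= _]mulrC ler_pdivrMr ?mul1r; last first.
    by rewrite mulr_gt0//; lra.
  by rewrite mulrC ler_wpM2l ?(ltW K0)//; lra.
have uE : pseries_sum r' c eps u by split=> //; exact: (pseries_sum_shrink r'r uc).2.
pose Phi e := kdelta 0 alpha \+ cauchy_prod c
   ((fun a => beta * e a) \+ (fun a => gamma * cauchy_prod e e a)).
have mdeg00 : mdeg (0 : I) = 0%N by apply/eqP; rewrite mdeg0.
have PhiB e : wbound r' e C -> wbound r' (Phi e) C.
  move=> eC; apply: (@wbound_weaken _ _ _ _ (`|alpha * r' ^+ mdeg (0 : I)| +
     eps * (`|beta| * C + `|gamma| * (C * C)))).
    rewrite mdeg00 expr0 mulr1 lerD2l; apply: le_trans epsK.
    by rewrite ler_wpM2l// /K; lra.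
  apply: wboundD; first exact: wbound_kdelta.
  apply: wbound_cauchy_prod => //; apply: wboundD; first exact: wboundZ.
  by apply: wboundZ; apply: wbound_cauchy_prod.
have PhiA e e' k : agree k e e' -> agree k.+1 (Phi e) (Phi e').
  move=> ee' a ak; congr (_ + _); apply: agree_cauchy_prodS ak => // b bk /=.
  by rewrite ee'// (agree_cauchy_prod ee' ee').
have [e eC efix] := formal_fixpoint (ltW C0) PhiA PhiB.
have ev := wbound_pseries_sum eC; set v := (fun t => _) in ev.
exists v; first by exists r', e, C.
exists r' => // t tr; split.
  rewrite normrM; apply: le_trans epsK.
  apply: ler_pM => //; first exact: pseries_sum_bound uE tr.
  by apply: le_trans (pseries_sum_bound ev tr) _; rewrite /K; lra.
(* The right-hand side of the equation has coefficients [Phi e], which equal [e], so both sides are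
   sums of one series. *)
have ev' := pseries_sumD (pseries_sum_kdelta r' 0 alpha) (pseries_sumM uE
  (pseries_sumD (pseries_sumZ beta ev) (pseries_sumZ gamma (pseries_sumM ev ev)))).
rewrite [LHS](pseries_sum_unique ev (pseries_sum_ext_coef efix ev') tr)/=.
by rewrite /monom big1 ?mulr1// => i _; rewrite ffunE expr0.
Qed.

(** * Operations on analytic germs *)

Implicit Types f g : ('I_d -> R) -> R.

Lemma analytic0_ext f g r : 0 < r ->
  (forall t, (forall i, `|t i| <= r) -> f t = g t) -> analytic0 f -> analytic0 g.
Proof.
move=> r0 fg [s [c [C [s0 cf]]]].
exists (Num.min r s), c, C; split; first by rewrite lt_min r0.
apply: (@pseries_sum_ext _ _ _ _ _ f) => [t tr|].
  by apply: fg => i; apply: le_trans (tr i) _; rewrite ge_min lexx.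
by apply: pseries_sum_shrink cf; rewrite le_min (ltW r0) (ltW s0)/= ge_min lexx orbT.
Qed.

Lemma analytic0_common f g : analytic0 f -> analytic0 g ->
  exists r c C e D, [/\ 0 < r, pseries_sum r c C f & pseries_sum r e D g].
Proof.
move=> [r [c [C [r0 cf]]]] [s [e [D [s0 eg]]]].
exists (Num.min r s), c, C, e, D; split; first by rewrite lt_min r0.
- by apply: pseries_sum_shrink cf; rewrite le_min (ltW r0) (ltW s0)/= ge_min lexx.
- by apply: pseries_sum_shrink eg; rewrite le_min (ltW r0) (ltW s0)/=
    ge_min lexx orbT.
Qed.

Lemma analytic0D f g : analytic0 f -> analytic0 g -> analytic0 (f \+ g).
Proof.
move=> /analytic0_common /[apply] -[r [c [C [e [D [r0 cf eg]]]]]].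
by do 3!eexists; split; [exact: r0 | exact: pseries_sumD cf eg].
Qed.

Lemma analytic0M f g : analytic0 f -> analytic0 g -> analytic0 (f \* g).
Proof.
move=> /analytic0_common /[apply] -[r [c [C [e [D [r0 cf eg]]]]]].
by do 3!eexists; split; [exact: r0 | exact: pseries_sumM cf eg].
Qed.

Lemma analytic0_cst (k : R) : analytic0 (fun _ : 'I_d -> R => k).
Proof.
apply: (@analytic0_ext (fun t => k * monom t 0) _ 1) => // [t _|].
  by rewrite /monom big1 ?mulr1// => i _; rewrite ffunE expr0.
by exists 1, (kdelta 0 k), `|k * 1 ^+ mdeg (0 : I)|; split=> //;
  apply: pseries_sum_kdelta.
Qed.

Lemma analytic0_coord j : analytic0 (fun t : 'I_d -> R => t j).
Proof.
pose a0 : I := [ffun i => (i == j : nat)].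
apply: (@analytic0_ext (fun t => 1 * monom t a0) _ 1) => // [t _|].
  rewrite mul1r /monom (bigD1 j)//= ffunE eqxx expr1 big1 ?mulr1// => i ij.
  by rewrite ffunE (negbTE ij) expr0.
by exists 1, (kdelta a0 1), `|1 * 1 ^+ mdeg a0|; split=> //;
  apply: pseries_sum_kdelta.
Qed.

Lemma analytic0_sum (J : Type) (s : seq J) (P : pred J) (f : J -> ('I_d -> R) -> R) :
  (forall j, P j -> analytic0 (f j)) ->
  analytic0 (fun t => \sum_(j <- s | P j) f j t).
Proof.
move=> fA; elim: s => [|j s IHs].
  apply: (@analytic0_ext (fun=> 0) _ 1) (analytic0_cst 0) => // t _.
  by rewrite big_nil.
have [Pj|Pj] := boolP (P j).
  apply: (@analytic0_ext _ _ 1) (analytic0D (fA j Pj) IHs) => // t _.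
  by rewrite big_cons Pj.
by apply: (@analytic0_ext _ _ 1) IHs => // t _; rewrite big_cons (negbTE Pj).
Qed.

Lemma analytic0_sub1 f : analytic0 f -> f (fun=> 0) != 0 ->
  exists2 u, analytic0 u & u (fun=> 0) = 0 /\
    forall t, f t = f (fun=> 0) * (1 - u t).
Proof.
move=> fA f0; exists (fun t => 1 + - (f (fun=> 0))^-1 * f t).
  apply: analytic0D (analytic0_cst 1) _.
  by apply: analytic0M => //; apply: analytic0_cst.
by split=> [|t]; [rewrite mulNr mulVf ?subrr | field].
Qed.

Lemma analytic0V f : analytic0 f -> f (fun=> 0) != 0 ->
  analytic0 (fun t => (f t)^-1).
Proof.
move=> fA f0; have [u uA [u0 fu]] := analytic0_sub1 fA f0.
have [v vA [r r0 uv]] := analytic_quadratic 1 1 0 uA u0.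
apply: (@analytic0_ext (fun t => (f (fun=> 0))^-1 * v t) _ r) => // [t tr|].
  have [_ vE] := uv t tr; have {}vE : (1 - u t) * v t = 1.
    by rewrite mulrBl {1}vE; ring.
  rewrite (fu t) invfM; congr (_ * _).
  have u1 : 1 - u t != 0.
    by apply/eqP => u1; move: vE; rewrite u1 mul0r => /eqP; rewrite eq_sym oner_eq0.
  by apply: (mulfI u1); rewrite vE divff.
by apply: analytic0M => //; apply: analytic0_cst.
Qed.

Lemma analytic0_sqrt f : analytic0 f -> 0 < f (fun=> 0) ->
  analytic0 (fun t => Num.sqrt (f t)).
Proof.
move=> fA f0; have [u uA [u0 fu]] := analytic0_sub1 fA (lt0r_neq0 f0).
have [v vA [r r0 uv]] := analytic_quadratic (2^-1) 0 (2^-1) uA u0.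
apply: (@analytic0_ext
    (fun t => Num.sqrt (f (fun=> 0)) * (1 + -1 * (u t * v t))) _ r) => // [t tr|].
  have [uv1 vE] := uv t tr; rewrite (fu t) sqrtrM ?(ltW f0)//; congr (_ * _).
  have -> : 1 - u t = (1 + -1 * (u t * v t)) ^+ 2.
    rewrite (_ : _ ^+ 2 = 1 - 2 * u t * v t + (u t * v t) ^+ 2); last by ring.
    by rewrite {1}vE; field.
  (* The bound [|u v| <= 1] makes [1 - u v] the nonnegative root. *)
  rewrite sqrtr_sqr ger0_norm//; move: uv1; rewrite ler_norml => /andP[_]; lra.
apply: analytic0M; first exact: analytic0_cst.
apply: analytic0D; first exact: analytic0_cst.
by apply: analytic0M; [apply: analytic0_cst | apply: analytic0M].
Qed.

End AnalyticFunctions.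

(** * Existence of the factorization *)

Section QuadraticForms.
Variable R : realType.
Implicit Types n : nat.

Lemma qf_mulmx_tr n (L : 'M[R]_n) (v : 'cV_n) :
  (v^T *m (L *m L^T) *m v) 0 0 = \sum_i ((L^T *m v) i 0) ^+ 2.
Proof.
rewrite !mulmxA -mulmxA -[v^T *m L]trmxK trmx_mul trmxK mxE.
by apply: eq_bigr => i _; rewrite !mxE expr2.
Qed.

Lemma sym_mulmx_tr n (L : 'M[R]_n) : sym_mx (L *m L^T).
Proof. by rewrite /sym_mx trmx_mul trmxK. Qed.

Lemma Lplus_unit n (L : 'M[R]_n) : Lplus L -> L \in unitmx.
Proof.
move=> [Ltrig L0]; rewrite unitmxE (det_trig Ltrig) unitfE.
by apply/prodf_neq0 => i _; rewrite gt_eqF.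
Qed.

Lemma posdef_mulmx_tr n (L : 'M[R]_n) : L \in unitmx -> posdef_mx (L *m L^T).
Proof.
move=> Lu; split=> [|v v0]; first exact: sym_mulmx_tr.
rewrite qf_mulmx_tr lt0r sumr_ge0 ?andbT => [|i _]; last exact: sqr_ge0.
apply: contra v0; rewrite psumr_eq0 => [/allP Lv|i _]; last exact: sqr_ge0.
have Lv0 : L^T *m v = 0.
  apply/matrixP => i j; rewrite ord1 [RHS]mxE.
  by apply/eqP; rewrite -sqrf_eq0; apply: (implyP (Lv i (mem_index_enum _))).
by rewrite -[v](mulKmx (_ : L^T \in unitmx)) ?unitmx_tr// Lv0 mulmx0.
Qed.

Lemma posdef_nonnegdef n (A : 'M[R]_n) : posdef_mx A -> nonnegdef_mx A.
Proof.
move=> [As A0]; split=> // v; have [->|/A0/ltW//] := eqVneq v 0.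
by rewrite mulmx0 mxE.
Qed.

(** A zero on the diagonal makes [L] singular, and a nonzero row vector [v] with [v L = 0]
    annihilates the quadratic form of [L L^T]. *)
Lemma posdef_factor_Lplus n (L : 'M[R]_n) : is_trig_mx L ->
  (forall i, 0 <= L i i) -> posdef_mx (L *m L^T) -> Lplus L.
Proof.
move=> Ltrig L0 [_ Lpos]; split=> // i; rewrite lt0r L0 andbT.
apply/negP => /eqP Lii; have /det0P[v v0 vL] : \det L == 0.
  by rewrite (det_trig Ltrig) (bigD1 i)//= Lii mul0r.
have /Lpos : v^T != 0 by apply: contra v0 => /eqP vT0; rewrite -[v]trmxK vT0 trmx0.
rewrite qf_mulmx_tr -trmx_mul vL big1 ?ltxx// => j _.
by rewrite !mxE expr0n.
Qed.

Lemma mulmx_tr_swap n (b v : 'cV[R]_n) : (v^T *m b) 0 0 = (b^T *m v) 0 0.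
Proof. by rewrite -[v^T *m b]trmxK trmx_mul trmxK mxE. Qed.

Lemma qf_block n (a : R) (b : 'cV[R]_n) (C : 'M[R]_n) (s : R) (y : 'cV[R]_n) :
  ((col_mx s%:M y : 'cV[R]_(1 + n))^T *m block_mx a%:M b^T b C
    *m col_mx s%:M y) 0 0 =
  s ^+ 2 * a + 2 * s * (b^T *m y) 0 0 + (y^T *m C *m y) 0 0.
Proof.
rewrite tr_col_mx mul_row_block mul_row_col !mulmxDl.
have yb := mulmx_tr_swap b y.
rewrite !tr_scalar_mx !mul_mx_scalar !mul_scalar_mx -!scalemxAl.
move: (y^T *m b) (b^T *m y) (y^T *m C *m y) yb => q1 q2 q3 yb.
by rewrite !mxE yb eqxx mulr1n; ring.
Qed.

(* In the elimination step, the column [l] below the pivot is 0 when the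
   pivot vanishes, since then so does the column [b] of [A]. *)
Lemma nonnegdef_cholesky n (A : 'M[R]_n) : nonnegdef_mx A ->
  exists L : 'M[R]_n, [/\ is_trig_mx L, forall i, 0 <= L i i & A = L *m L^T].
Proof.
elim: n => [|n IHn] in A *.
  by move=> _; exists 0; split=> [| |]; [apply/is_trig_mxP| |apply/matrixP]; case.
rewrite -[n.+1]/(1 + n)%N in A *.
move=> [As Ann]; pose a : R := A 0 0; pose b := dlsubmx A; pose C := drsubmx A.
have Ab : A = block_mx a%:M b^T b C.
  rewrite -[LHS]submxK; congr block_mx.
    by apply/matrixP => i j; rewrite !ord1 !mxE eqxx mulr1n !lshift0.
  by rewrite /b trmx_dlsub As.
have Cs : sym_mx C by rewrite /sym_mx /C trmx_drsub As.
have qf (s : R) (y : 'cV[R]_n) :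
    0 <= s ^+ 2 * a + 2 * s * (b^T *m y) 0 0 + (y^T *m C *m y) 0 0.
  by rewrite -qf_block -Ab; apply: Ann.
have a0 : 0 <= a by have := qf 1 0; rewrite !mulmx0 !mxE; lra.
(* The first column of the factor is [sqrt a] above [l]; induction factors the remaining block
   [C - l l^T]. *)
suff [l [al bl]] : exists l : 'cV[R]_n, b = Num.sqrt a *: l /\
    nonnegdef_mx (C - l *m l^T).
  have [L [Lt L0 CL]] := IHn _ bl.
  exists (block_mx (Num.sqrt a)%:M 0 l L); split.
  - by rewrite is_trig_block_mx// eqxx scalar_mx_is_trig.
  - move=> i; case: (split_ordP i) => j ->.
      by rewrite block_mxEul ord1 mxE eqxx mulr1n sqrtr_ge0.
    by rewrite block_mxEdr.
  rewrite Ab tr_block_mx mulmx_block !trmx0 !mulmx0 !mul0mx !addr0 -CL.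
  rewrite tr_scalar_mx -scalar_mxM -expr2 sqr_sqrtr// mul_scalar_mx mul_mx_scalar.
  by rewrite addrC subrK -al al linearZ.
have [a_eq0|a_neq0] := eqVneq a 0.
  exists 0; rewrite trmx0 mulmx0 subr0 scaler0; split.
    apply/matrixP => i j; rewrite ord1 [RHS]mxE.
    have {}qf s : 0 <= 2 * s * b i 0 + C i i.
      have := qf s (delta_mx i 0); rewrite a_eq0 mulr0 add0r.
      by rewrite trmx_delta -rowE -!colE !mxE.
    have [//|bi0] := eqVneq (b i 0) 0.
    (* With [a = 0] the form is affine in [s]; this [s] would give it the value -1. *)
    have := qf (- (C i i + 1) / (2 * b i 0)).
    have -> : 2 * (- (C i i + 1) / (2 * b i 0)) * b i 0 + C i i = -1 by field.
    by rewrite oppr_ge0 ler10.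
  by split=> // v; have := qf 0 v; rewrite a_eq0; lra.
have s0 : Num.sqrt a != 0 by rewrite sqrtr_eq0 -ltNge lt0r a_neq0.
have sa : Num.sqrt a ^+ 2 = a by rewrite sqr_sqrtr.
exists ((Num.sqrt a)^-1 *: b); split; first by rewrite scalerA divff// scale1r.
split=> [|v]; first by rewrite /sym_mx linearB/= trmx_mul trmxK Cs.
have yb := mulmx_tr_swap b v.
(* This [s] minimizes the quadratic polynomial in [s], and the minimum is the form of the Schur
   complement at [v]. *)
have := qf (- (b^T *m v) 0 0 / a) v; congr (_ <= _).
have -> : v^T *m (C - ((Num.sqrt a)^-1 *: b) *m ((Num.sqrt a)^-1 *: b)^T) *m v =
    v^T *m C *m v - (Num.sqrt a)^-1 ^+ 2 *: ((v^T *m b) *m (b^T *m v)).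
  rewrite mulmxBr mulmxBl linearZ/= -!scalemxAl -!scalemxAr -!scalemxAl scalerA.
  by rewrite expr2 !mulmxA.
move: (v^T *m b) (b^T *m v) (v^T *m C *m v) yb => q1 q2 q3 yb.
by rewrite !mxE big_ord1 yb exprVn sa; field.
Qed.

End QuadraticForms.

(** * The Cholesky algorithm is analytic *)

Section AnalyticGerms.
Variables (R : realType).

Definition lin_comb (V : vectType R) (E : {vspace V}) (t : 'I_(\dim E) -> R) : V :=
  \sum_i t i *: (vbasis E)`_i.

Arguments lin_comb {V} E t.

(** Every [h] in [E] is [lin_comb E t] for its coordinates [t], and the weighted bound gives
    absolute convergence throughout the polydisc. *)
Lemma analytic0_at (V : vectType R) (E : {vspace V}) (f : V -> R) (x : V) :
  analytic0 (fun t => f (x + lin_comb E t)) -> analytic_at E f x.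
Proof.
move=> [r [c [C [r0 [cC cf]]]]]; exists r, c; split=> // h hE t tr.
have tr' i : `|t i| <= r by apply: ltW.
split; last by have := cf t tr'; rewrite /lin_comb -coord_vbasis.
rewrite /pseries_abs_cvg pseries_psumE; apply: (@boxsum_cvg _ _ _ C).
have : abs_bound (fun a => c a * monom (fun i => `|t i|) a) C.
  by apply: wbound_monom cC => i; rewrite normr_id.
by apply: abs_bound_le => a; rewrite !normrM normr_id.
Qed.

Definition analytic_entries m n p q (E : {vspace 'M[R]_(m, n)})
    (f : 'M[R]_(m, n) -> 'M[R]_(p, q)) (x : 'M[R]_(m, n)) :=
  forall i j, analytic0 (fun t => f (x + lin_comb E t) i j).

(** Coordinates in a basis of [E'] are fixed linear combinations of matrix entries, so it suffices
    to treat entries. *)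
Lemma analytic_map_entries m n p q (E : {vspace 'M[R]_(m, n)}) (U : set 'M[R]_(m, n))
    (E' : {vspace 'M[R]_(p, q)}) (f : 'M[R]_(m, n) -> 'M[R]_(p, q)) :
    (forall x, U x -> f x \in E') ->
    (forall x, U x -> analytic_entries E f x) ->
  analytic_map E U E' f.
Proof.
move=> fE' fA x Ux; split=> [|k]; first exact: fE'.
apply: analytic0_at.
apply: (@analytic0_ext _ _ (fun t => \sum_i \sum_j
  (f (x + lin_comb E t) i j * coord (vbasis E') k (delta_mx i j))) _ 1) => // [t _|].
  rewrite [in RHS](matrix_sum_delta (f _)) linear_sum; apply: eq_bigr => i _.
  by rewrite linear_sum; apply: eq_bigr => j _; rewrite linearZ.
apply: analytic0_sum => i _; apply: analytic0_sum => j _.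
by apply: analytic0M; [exact: fA | exact: analytic0_cst].
Qed.

Lemma analytic_entries_id m n (E : {vspace 'M[R]_(m, n)}) x :
  analytic_entries E id x.
Proof.
move=> i j; apply: (@analytic0_ext _ _
    (fun t => x i j + \sum_k (t k * (vbasis E)`_k i j)) _ 1) => // [t _|].
  by rewrite mxE summxE; congr (_ + _); apply: eq_bigr => k _; rewrite mxE.
apply: analytic0D; first exact: analytic0_cst.
apply: analytic0_sum => k _.
by apply: analytic0M; [exact: analytic0_coord | exact: analytic0_cst].
Qed.

Lemma analytic_entries_mulmx_tr m n p q (E : {vspace 'M[R]_(m, n)})
    (f : 'M[R]_(m, n) -> 'M[R]_(p, q)) x :
  analytic_entries E f x -> analytic_entries E (fun y => f y *m (f y)^T) x.
Proof.
move=> fA i j; apply: (@analytic0_ext _ _ (fun t => \sum_k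
    (f (x + lin_comb E t) i k * f (x + lin_comb E t) j k)) _ 1) => // [t _|].
  by rewrite mxE; apply: eq_bigr => k _; rewrite mxE.
by apply: analytic0_sum => k _; apply: analytic0M; apply: fA.
Qed.

Lemma lin_comb0 (V : vectType R) (E : {vspace V}) :
  lin_comb E (fun _ : 'I_(\dim E) => 0) = 0.
Proof. by rewrite /lin_comb big1// => i _; rewrite scale0r. Qed.

(** * The column-by-column Cholesky algorithm *)

Variable n : nat.
Implicit Types A L : 'M[R]_n.

(** Fills column [k] from the residual [S] left by the earlier columns, dividing by the root of its
    pivot. The formula is total, but meaningful only for a positive pivot. *)
Definition chol_step A k C : 'M[R]_n :=
  let S := A - C *m C^T in
  \matrix_(i, j) if (j == k :> nat) then
    (if (i < j)%N then 0 else S i j * (Num.sqrt (S j j))^-1)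
  else C i j.

(* [chol k A] has the first [k] columns of the Cholesky factor of [A], followed
   by zero columns. *)
Fixpoint chol k A : 'M[R]_n :=
  if k is k'.+1 then chol_step A k' (chol k' A) else 0.

Lemma cholS k A i j : let S := A - chol k A *m (chol k A)^T in
  chol k.+1 A i j = if (j == k :> nat) then
    (if (i < j)%N then 0 else S i j * (Num.sqrt (S j j))^-1) else chol k A i j.
Proof. by rewrite /= [LHS]mxE. Qed.

Lemma chol_trig k A : is_trig_mx (chol k A).
Proof.
apply/is_trig_mxP => i j ij; elim: k => [|k IHk]; first by rewrite mxE.
by rewrite cholS ij IHk if_same.
Qed.

(** In the sum over [l] for the entry, terms with [l < j] cancel against the columns already found,
    and those with [l > j] vanish by triangularity of row [j]. *)
Lemma chol_schur k L (j i : 'I_n) : is_trig_mx L -> j = k :> nat ->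
    chol k (L *m L^T) = \matrix_(i, j) (if (j < k)%N then L i j else 0) ->
  (L *m L^T - chol k (L *m L^T) *m (chol k (L *m L^T))^T) i j = L i j * L j j.
Proof.
move=> /is_trig_mxP Lt jk ->; rewrite !mxE -sumrB (bigD1 j)//= !mxE jk ltnn.
rewrite mul0r subr0 big1 ?addr0// => l lj; rewrite !mxE.
case: ltngtP => [lk|kl|lk]; first by rewrite subrr.
- by rewrite (Lt j l) ?jk// mul0r mulr0 subrr.
- by case/eqP: lj; apply: val_inj; rewrite /= lk.
Qed.

Lemma chol_prefix k L : Lplus L ->
  chol k (L *m L^T) = \matrix_(i, j) (if (j < k)%N then L i j else 0).
Proof.
move=> [Lt L0]; elim: k => [|k IHk]; first by apply/matrixP => i j; rewrite !mxE.
apply/matrixP => i j; rewrite cholS [RHS]mxE ltnS [in RHS]leq_eqVlt.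
case: eqP => [jk|_]; last by rewrite IHk mxE.
(* The pivot is [L j j ^+ 2], whose root is [L j j] by positivity. *)
rewrite !(chol_schur _ Lt jk IHk) -expr2 sqrtr_sqr gtr0_norm// mulfK ?gt_eqF//.
by case: ifP => // ij; rewrite (is_trig_mxP Lt).
Qed.

(** This left inverse yields injectivity of [Fmap] on [Lplus], the inverse map, and uniqueness of
    the decomposition. *)
Lemma chol_mulmx_tr L : Lplus L -> chol n (L *m L^T) = L.
Proof.
by move=> /(chol_prefix n) ->; apply/matrixP => i j; rewrite mxE ltn_ord.
Qed.

(** Induction on columns. The root and the inverse are legitimate because the pivot at the centre
    [L L^T] is the square of a positive diagonal entry. *)
Lemma analytic_entries_chol k (E : {vspace 'M[R]_n}) L : Lplus L ->
  analytic_entries E (chol k) (L *m L^T).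
Proof.
move=> LP; have [Lt L0] := LP; elim: k => [|k IHk] i j.
  apply: (@analytic0_ext _ _ (fun=> 0) _ 1) => // [t _|]; first by rewrite mxE.
  exact: analytic0_cst.
pose S y := y - chol k y *m (chol k y)^T.
have SA : analytic_entries E S (L *m L^T).
  move=> i' j'; apply: (@analytic0_ext _ _ (fun t => (L *m L^T + lin_comb E t) i' j' +
      -1 * (chol k (L *m L^T + lin_comb E t) *m
            (chol k (L *m L^T + lin_comb E t))^T) i' j') _ 1) => // [t _|].
    by rewrite [in RHS]mxE [X in _ = _ + X]mxE mulN1r.
  apply: analytic0D; first exact: analytic_entries_id.
  apply: analytic0M; first exact: analytic0_cst.
  exact: (analytic_entries_mulmx_tr IHk).
have [jk|jk] := eqVneq (j : nat) k; last first.
  apply: (@analytic0_ext _ _ (fun t => chol k (L *m L^T + lin_comb E t) i j) _ 1) => //.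
  by move=> t _; rewrite cholS (negbTE jk).
have [ij|ij] := boolP (i < j)%N.
  apply: (@analytic0_ext _ _ (fun=> 0) _ 1) => // [t _|]; last exact: analytic0_cst.
  by rewrite cholS ij jk eqxx.
apply: (@analytic0_ext _ _ (fun t => S (L *m L^T + lin_comb E t) i j *
    (Num.sqrt (S (L *m L^T + lin_comb E t) j j))^-1) _ 1) => // [t _|].
  by rewrite cholS (negbTE ij) jk eqxx.
have S0 : 0 < S (L *m L^T + lin_comb E (fun _ : 'I_(\dim E) => 0)) j j.
  rewrite lin_comb0 addr0 /S (chol_schur _ Lt jk (chol_prefix k LP)).
  by rewrite mulr_gt0.
apply: analytic0M => //; apply: analytic0V; last by rewrite gt_eqF// sqrtr_gt0.
exact: analytic0_sqrt.
Qed.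

End AnalyticGerms.

(** * Topology of matrix spaces *)

Section MatrixTopology.
Variable R : realType.

Lemma continuous_mx (T : topologicalType) m n (f : T -> 'M[R]_(m, n)) :
  (forall i j, continuous (fun x => f x i j)) -> continuous f.
Proof.
move=> fc x A [P xP PA]; have : nbhs x (fun y => forall i j, P i j (f y i j)).
  apply: filter_forall => i; apply: filter_forall => j.
  exact: (fc i j x _ (xP i j)).
by apply: filterS => y; apply: PA.
Qed.

Lemma continuous_big_sum (T : topologicalType) (I : Type) (r : seq I)
    (f : I -> T -> R) :
  (forall i, continuous (f i)) -> continuous (fun x => \sum_(i <- r) f i x).
Proof.
move=> fc x; elim: r => [|i r IHr].
  rewrite (_ : (fun _ => _) = fun=> 0); first exact: cst_continuous.
  by apply/funext => y; rewrite big_nil.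
rewrite (_ : (fun _ => _) = fun y => f i y + \sum_(j <- r) f j y).
  exact: (continuousD (fc i x) IHr).
by apply/funext => y; rewrite big_cons.
Qed.

Lemma continuous_mulmx (T : topologicalType) m n p (f : T -> 'M[R]_(m, n))
    (g : T -> 'M[R]_(n, p)) :
  continuous f -> continuous g -> continuous (fun x => f x *m g x).
Proof.
move=> fc gc; apply: continuous_mx => i j.
rewrite (_ : (fun _ => _) = fun x => \sum_k f x i k * g x k j); last first.
  by apply/funext => x; rewrite mxE.
apply: continuous_big_sum => k x; apply: continuousM.
  exact: (@continuous_comp _ _ _ f (fun M => M i k) x (fc x)
    (@coord_continuous _ _ _ _ _ _)).
exact: (@continuous_comp _ _ _ g (fun M => M k j) x (gc x)
  (@coord_continuous _ _ _ _ _ _)).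
Qed.

Lemma continuous_trmx m n : continuous (@trmx R m n).
Proof.
apply: continuous_mx => i j; rewrite (_ : (fun _ => _) = fun A : 'M[R]_(m, n) => A j i).
  exact: coord_continuous.
by apply/funext => A; rewrite mxE.
Qed.

Lemma continuous_Fmap n : continuous (@Fmap R n).
Proof. by apply: continuous_mulmx; [move=> x; exact: cvg_id | exact: continuous_trmx]. Qed.

(** Through [vec_mx], [A] is a continuous image of a closed subset of a product of segments. *)
Lemma bounded_closed_mx_compact m n (A : set 'M[R]_(m, n)) (M : R) :
  closed A -> (forall x, A x -> forall i j, `|x i j| <= M) -> compact A.
Proof.
move=> Acl AM.
have vec_c : continuous (@vec_mx R m n).
  apply: continuous_mx => i j.
  rewrite (_ : (fun _ => _) = fun v : 'rV[R]_(m * n) => v 0 (mxvec_index i j)).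
    exact: coord_continuous.
  by apply/funext => v; rewrite mxE.
have -> : A = vec_mx @` (vec_mx @^-1` A).
  apply/seteqP; split=> [x Ax|_ [v Av <-]//].
  by exists (mxvec x); rewrite /= mxvecK.
apply: continuous_compact; first exact: continuous_subspaceT.
apply: (subclosed_compact _
  (rV_compact (fun _ => segment_compact (a := - M) (b := M)))).
  by apply: preimage_closed => // x _; apply: vec_c.
move=> v Av k /=; rewrite in_itv/= -ler_norml.
by case: (mxvec_indexP k) => i j; have := AM _ Av i j; rewrite mxE.
Qed.

Lemma compact_mx_bounded m n (K : set 'M[R]_(m, n)) : compact K ->
  exists M : R, forall x, K x -> forall i j, `|x i j| <= M.
Proof.
move=> /compact_bounded[M [_ KM]]; exists (M + 1) => x Kx i j.
apply: le_trans (KM (M + 1) _ x Kx); last by rewrite ltrDl.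
by rewrite [leRHS]/Num.Def.normr /= mx_normrE; apply/bigmax_geP; right => /=;
  exists (i, j).
Qed.

(** The congruence [G B = L^-1 B L^-T] sends [A] to the identity, so for [B] near [A] all entries of
    [1 - G B] are below some [eta] with [eta * n < 1]; its form is then strictly smaller than the
    sum of squares. *)
Lemma near_posdef n (A : 'M[R]_n) (L : 'M[R]_n) : L \in unitmx -> A = L *m L^T ->
  \forall B \near A, forall v : 'cV[R]_n, v != 0 -> 0 < (v^T *m B *m v) 0 0.
Proof.
move=> Lu AL; pose G B := invmx L *m B *m (invmx L)^T.
have Gc : continuous G.
  apply: continuous_mulmx; last by move=> x; apply: cst_continuous.
  by apply: continuous_mulmx => x; [apply: cst_continuous | apply: cvg_id].
have GA : G A = 1%:M.
  by rewrite /G AL !mulmxA mulVmx// mul1mx -trmx_mul mulVmx// trmx1.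
have [eta eta0 etan] : exists2 eta : R, 0 < eta & eta * n%:R < 1.
  exists n.+1%:R^-1; first by rewrite invr_gt0.
  by rewrite mulrC ltr_pdivrMr// mul1r ltr_nat.
have near1 : nbhs (G A) [set M | forall i j, `|(1%:M : 'M[R]_n) i j - M i j| < eta].
  rewrite GA; exists (fun i j => ball ((1%:M : 'M[R]_n) i j) eta) => //.
  by move=> i j; apply: nbhsx_ballx.
have nearA : nbhs A [set B | forall i j, `|(1%:M : 'M[R]_n) i j - G B i j| < eta].
  exact: Gc A _ near1.
apply: filterS nearA => B /= BA v v0.
have [w vw] : exists w, v = (invmx L)^T *m w.
  by exists (L^T *m v); rewrite mulmxA -trmx_mul mulmxV// trmx1 mul1mx.
have -> : v^T *m B *m v = w^T *m G B *m w.
  by rewrite {1 2}vw trmx_mul trmxK !mulmxA.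
have w0 : w != 0 by apply: contra v0 => /eqP w0; rewrite vw w0 mulmx0.
have wE : (w^T *m G B *m w) 0 0 = \sum_j \sum_i w i 0 * G B i j * w j 0.
  rewrite mxE; apply: eq_bigr => j _; rewrite mxE mulr_suml.
  by apply: eq_bigr => i _; rewrite mxE.
pose W := \sum_i w i 0 ^+ 2.
have W0 : 0 < W.
  rewrite lt0r sumr_ge0 ?andbT => [|i _]; last exact: sqr_ge0.
  apply: contra w0; rewrite psumr_eq0 => [/allP w0|i _]; last exact: sqr_ge0.
  apply/eqP/matrixP => i j; rewrite ord1 [RHS]mxE; apply/eqP.
  by rewrite -sqrf_eq0; apply: (implyP (w0 i (mem_index_enum _))).
have W1 : W = \sum_j \sum_i w i 0 * (1%:M : 'M[R]_n) i j * w j 0.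
  apply: eq_bigr => j _; rewrite (bigD1 j)//= mxE eqxx mulr1 -expr2 big1 ?addr0//.
  by move=> i ij; rewrite mxE (negbTE ij) mulr0 mul0r.
have W2 : \sum_j \sum_i eta * ((w i 0 ^+ 2 + w j 0 ^+ 2) / 2) = eta * n%:R * W.
  under eq_bigr do rewrite -mulr_sumr -mulr_suml big_split/= sumr_const card_ord -/W.
  rewrite -mulr_sumr -mulr_suml big_split/= sumr_const card_ord sumrMnl -/W.
  by rewrite -mulr2n -[_ *+ 2]mulr_natr mulfK ?pnatr_eq0// [LHS]mulrnAr
    [RHS]mulrAC mulr_natr.
have WG : W - (w^T *m G B *m w) 0 0 <= eta * n%:R * W.
  rewrite wE {1}W1 -W2 -sumrB; apply: ler_sum => j _; rewrite -sumrB.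
  apply: ler_sum => i _; rewrite -mulrBl -mulrBr mulrAC.
  apply: le_trans (ler_norm _) _; rewrite normrM mulrC.
  apply: ler_pM => //; first exact: ltW.
  rewrite normrM -(normr_id (w i 0)) -[leRHS]/(_ / 2).
  rewrite -[w i 0 ^+ 2]real_normK ?num_real//.
  rewrite -[w j 0 ^+ 2]real_normK ?num_real//.
  (* Arithmetic-geometric mean inequality for [|w i 0|] and [|w j 0|]. *)
  by have := sqr_ge0 (`|w i 0| - `|w j 0|); rewrite normr_id; nra.
have : eta * n%:R * W < W.
  by rewrite gtr_pMl.
lra.
Qed.

End MatrixTopology.

(** * Properness, the diffeomorphism and the decomposition *)

Theorem theorem2 (R : realType) (n : nat) (hn : (1 <= n)%N) :
  [/\ (* (1) *)
      proper_map (closure (@Lplus R n)) (closure (@Splus R n)) (@Fmap R n),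
      (* (2) *)
      analytic_diffeo (ltrig_space R n) (@Lplus R n)
        (sym_space R n) (@Fmap R n @` @Lplus R n) (@Fmap R n) /\
      @Fmap R n @` @Lplus R n = @Splus R n,
      (* (3), existence *)
      forall A : 'M[R]_n, nonnegdef_mx A ->
        exists L : 'M[R]_n,
          [/\ is_trig_mx L, forall i, 0 <= L i i & A = L *m L^T] &
      (* (3), uniqueness *)
      forall A : 'M[R]_n, posdef_mx A ->
        forall L1 L2 : 'M[R]_n,
          [/\ is_trig_mx L1, forall i, 0 <= L1 i i & A = L1 *m L1^T] ->
          [/\ is_trig_mx L2, forall i, 0 <= L2 i i & A = L2 *m L2^T] ->
          L1 = L2].
Proof.
have FS : @Fmap R n @` @Lplus R n = @Splus R n.
  apply/seteqP; split=> [_ [L /Lplus_unit Lu <-]|A Apos].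
    exact: posdef_mulmx_tr.
  have [L [Lt L0 AL]] := nonnegdef_cholesky (posdef_nonnegdef Apos).
  by exists L => //; apply: posdef_factor_Lplus; rewrite -?AL.
have Fc := @continuous_Fmap R n.
split.
(* By continuity, a neighbourhood of [Fmap L] pulls back to one of [L], which meets [Lplus]; hence
   closure maps into closure. *)
- split=> [L Lcl B FB|K _ Kc].
    have [L' [L'P L'B]] := Lcl _ (Fc L _ FB); exists (Fmap L'); split=> //.
    by rewrite -FS; exists L'.
  have [M KM] := compact_mx_bounded Kc.
  (* Row [i] of [L] has sum of squares [(L L^T) i i <= M], and [2 |x| <= 1 + x^2] turns this into a
     bound on entries. *)
  apply: (@bounded_closed_mx_compact _ _ _ _ (1 + M)).
    apply: closedI; first exact: closed_closure.
    apply: preimage_closed => [x _|]; first exact: Fc.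
    exact: compact_closed (@norm_hausdorff _ _) Kc.
  move=> L [_ KL] i j.
  have Lij : L i j ^+ 2 <= M.
    apply: le_trans (KM _ KL i i); apply: le_trans (ler_norm _).
    rewrite mxE (bigD1 j)//= mxE -expr2 lerDl.
    by apply: sumr_ge0 => k _; rewrite mxE -expr2 sqr_ge0.
  rewrite -real_normK ?num_real// in Lij.
  by have := sqr_ge0 (`|L i j| - 1); nra.
- split=> //; split.
  + exists [set L | forall i, 0 < L i i].
      rewrite openE => L L0.
      apply: (@filter_forall _ _ (fun i (M : 'M[R]_n) => 0 < M i i) (nbhs L)) => i.
      exact: (cvgr_gt (L i i) (@coord_continuous R n n i i L) 0 (L0 i)).
    apply/seteqP; split=> [L [Lt L0]|L [L0 Lt]].
      by split=> //=; rewrite mem_ltrig_space.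
    by split=> //; rewrite -mem_ltrig_space.
  + rewrite FS.
    (* The interior is taken among all matrices, symmetric or not; [near_posdef] puts each positive
       definite matrix in it. *)
    exists [set A : 'M[R]_n | forall v : 'cV[R]_n, v != 0 -> 0 < (v^T *m A *m v) 0 0]°.
      exact: open_interior.
    apply/seteqP; split=> [A Apos|A [/nbhs_singleton A0 /mem_sym_space As]//].
    split; last by apply/mem_sym_space; case: Apos.
    have : (@Fmap R n @` @Lplus R n) A by rewrite FS.
    by move=> [L /Lplus_unit Lu FL]; apply: (near_posdef Lu).
  + split=> [L LP|L1 L2 /set_mem L1P /set_mem L2P FL|_ [L LP <-]].
    * by exists L.
    * by rewrite -(chol_mulmx_tr L1P) -(chol_mulmx_tr L2P) -/(Fmap L1) FL.
    * by exists L.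
  + apply: analytic_map_entries => L _.
      by apply/mem_sym_space; apply: sym_mulmx_tr.
    exact: analytic_entries_mulmx_tr (@analytic_entries_id _ _ _ _ _).
  + exists (@chol R n n); split=> [L LP|]; first exact: chol_mulmx_tr.
    apply: analytic_map_entries => _ [L LP <-].
      by rewrite mem_ltrig_space chol_trig.
    exact: analytic_entries_chol.
- by move=> A; apply: nonnegdef_cholesky.
- move=> A Apos L1 L2 [L1t L10 AL1] [L2t L20 AL2].
  have L1P : Lplus L1 by apply: posdef_factor_Lplus; rewrite -?AL1.
  have L2P : Lplus L2 by apply: posdef_factor_Lplus; rewrite -?AL2.
  by rewrite -(chol_mulmx_tr L1P) -AL1 AL2 chol_mulmx_tr.
Qed.
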